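(* Let $n\ge 1$ and $m\ge 0$ be integers and let $i_1,\dots,i_m\in\{1,\dots,2n\}$. There exists a polynomial $Q\in\mathbb{Q}(q)[y_1,\dots,y_{2n(2n+1)}]$ of total degree at most $m$ such that for all families of nonnegative integers $(\alpha_{i,j})_{1\le i\ne j\le 2n}$, $(\beta_i)_{1\le i\le 2n}$, $(\gamma_i)_{1\le i\le 2n}$, $$\mathbf{D}_{i_1}\circ\cdots\circ\mathbf{D}_{i_m}\big(P(\alpha_{i,j}|\beta_i|\gamma_i)\big)\Big|_{z_1=\cdots=z_{2n}=1}=Q\big((\alpha_{i,j}),(\beta_i),(\gamma_i)\big).$$
   Context: $q$ is a variable. For $1\le k\le 2n$ (with $z_{2n+1}:=z_1$, i.e. the index $2n+1$ is identified with $1$), the linear maps $\mathbf{S}_k,\mathbf{D}_k:\mathbb{Q}(q)[z_1,\dots,z_{2n}]\to\mathbb{Q}(q)[z_1,\dots,z_{2n}]$ are defined as follows: $\mathbf{S}_k(f)$ is $f$ with the variables $z_k$ and $z_{k+1}$ interchanged, and $$\mathbf{D}_k(f)=\frac{qz_k-q^{-1}z_{k+1}}{z_{k+1}-z_k}\,(\mathbf{S}_k(f)-f).$$ For $1\le i\ne j\le 2n$ put $$f(i,j)=\frac{qz_i-q^{-1}z_j}{q-q^{-1}},\qquad g(i)=\frac{q-q^{-1}z_i}{q-q^{-1}},\qquad h(i)=\frac{qz_i-q^{-1}}{q-q^{-1}},$$ and for nonnegative integers $\alpha_{i,j},\beta_i,\gamma_i$, $$P(\alpha_{i,j}|\beta_i|\gamma_i):=\prod_{1\le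 i\ne j\le 2n}f(i,j)^{\alpha_{i,j}}\prod_{i=1}^{2n}g(i)^{\beta_i}h(i)^{\gamma_i},$$ where the first product runs over all ordered pairs $(i,j)$ with $i\neq j$. The number of parameters $\alpha_{i,j},\beta_i,\gamma_i$ is $2n(2n-1)+2n+2n=2n(2n+1)$. *)

(* Defs.v *)
From HB Require Import structures.
From mathcomp Require Import all_boot all_order all_algebra all_fingroup.
From mathcomp Require Import mpoly.

Set Implicit Arguments.
Unset Strict Implicit.
Unset Printing Implicit Defensive.

Import GRing.Theory.
Local Open Scope ring_scope.

(* Q(q) and its variable q.  The constructions below make sense for any element
   q of any field K, and are stated in that generality because conversion in
   the concrete field Qq is slow. *)
Definition Qq : fieldType := {fraction {poly rat}}.
Definition qq : Qq := tofrac 'X.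

(* The variable z_i (1 <= i <= 2n) is 'X_j with j = i - 1 : 'I_(2 * n). *)
Notation polz K n := {mpoly K[2 * n]}.

(* [ordS] is the cyclic successor on 'I_(2 * n), so it sends 2n - 1 to 0. *)
Definition Sk (K : fieldType) (n : nat) (k : 'I_(2 * n)) (f : polz K n) :
    polz K n :=
  msym (tperm k (ordS k)) f.

Lemma ordS_neq (n : nat) (k : 'I_(2 * n)) : k != ordS k.
Proof.
apply/eqP => /(congr1 val) /= e.
have lt_k := ltn_ord k; move: e.
have [lt_k1|le_k1] := ltnP k.+1 (2 * n).
  by rewrite modn_small // => /eqP; rewrite ltn_eqF.
have e1 : k.+1 = (2 * n)%N by apply/eqP; rewrite eqn_leq lt_k le_k1.
rewrite e1 modnn => k0.
by move: e1; rewrite k0 => /(congr1 odd); rewrite mul2n odd_double.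
Qed.

Lemma Sk_sub_dvd (K : fieldType) (n : nat) (k : 'I_(2 * n)) (f : polz K n) :
  exists g : polz K n, ('X_(ordS k) - 'X_k) * g == Sk k f - f.
Proof.
pose dvd (p : polz K n) := exists g : polz K n, ('X_(ordS k) - 'X_k) * g = Sk k p - p.
suff [g <-] : dvd f by exists g.
have dvd0 : dvd 0 by exists 0; rewrite /Sk msym0 subrr mulr0.
have dvd1 : dvd 1 by exists 0; rewrite /Sk msym1 subrr mulr0.
have dvdD a b : dvd a -> dvd b -> dvd (a + b).
  case=> [ga ea] [gb eb]; exists (ga + gb).
  by rewrite mulrDr ea eb /Sk msymD opprD addrACA.
have dvdZ c a : dvd a -> dvd (c *: a).
  by case=> [ga ea]; exists (c *: ga); rewrite -scalerAr ea /Sk msymZ scalerBr.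
have dvdM a b : dvd a -> dvd b -> dvd (a * b).
  case=> [ga ea] [gb eb]; exists (Sk k a * gb + ga * b).
  rewrite mulrDr mulrCA eb mulrA ea /Sk msymM.
  by rewrite mulrBr mulrBl addrA subrK.
have dvdX i : dvd 'X_i.
  have SX : Sk k 'X_i = 'X_(tperm k (ordS k) i) :> polz K n.
    rewrite /Sk msymX; congr mpolyX; apply/mnmP => j.
    rewrite mnmE !mnm1E tpermV; congr (nat_of_bool _).
    by apply/eqP/eqP => [->|<-]; rewrite tpermK.
  rewrite /dvd SX; case: tpermP => [->|->|_ _].
  - by exists 1; rewrite mulr1.
  - by exists (-1); rewrite mulrN1 opprB.
  - by exists 0; rewrite mulr0 subrr.
rewrite (mpolyE f); elim/big_ind: _ => // m _; apply: dvdZ.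
rewrite mpolyXE_id; elim/big_ind: _ => // i _.
by elim: (m i) => [|e IHe]; rewrite ?expr0 // exprS; apply: dvdM.
Qed.

(* The polynomial (Sk k f - f) / (z_{k+1} - z_k); unique, by [divdiffE] and
   [subX_neq0]. *)
Definition divdiff (K : fieldType) (n : nat) (k : 'I_(2 * n)) (f : polz K n) :
    polz K n :=
  xchoose (Sk_sub_dvd k f).

Definition Dk (K : fieldType) (q : K) (n : nat) (k : 'I_(2 * n)) (f : polz K n) :
    polz K n :=
  (q *: 'X_k - q^-1 *: 'X_(ordS k)) * divdiff k f.

Lemma divdiffE (K : fieldType) (n : nat) (k : 'I_(2 * n)) (f : polz K n) :
  ('X_(ordS k) - 'X_k) * divdiff k f = Sk k f - f.
Proof. exact/eqP/(xchooseP (Sk_sub_dvd k f)). Qed.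

Lemma subX_neq0 (K : fieldType) (n : nat) (k : 'I_(2 * n)) :
  'X_(ordS k) - 'X_k != 0 :> polz K n.
Proof.
apply/eqP => /(congr1 (fun p : polz K n => p@_(U_(k)%MM))).
rewrite mcoeffB !mcoeffXU mcoeff0 eqxx eq_sym (negbTE (ordS_neq k)) sub0r.
by move/eqP; rewrite oppr_eq0 oner_eq0.
Qed.

Lemma DkE (K : fieldType) (q : K) (n : nat) (k : 'I_(2 * n)) (f : polz K n) :
  ('X_(ordS k) - 'X_k) * Dk q k f =
  (q *: 'X_k - q^-1 *: 'X_(ordS k)) * (Sk k f - f).
Proof. by rewrite mulrCA divdiffE. Qed.

Lemma Dk_is_linear (K : fieldType) (q : K) (n : nat) (k : 'I_(2 * n)) :
  linear (@Dk K q n k).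
Proof.
move=> c a b; apply: (mulfI (subX_neq0 K k)).
have := DkE q k b; have := DkE q k a; have := DkE q k (c *: a + b).
move: (Dk q k (c *: a + b)) (Dk q k a) (Dk q k b) => dc da db.
move: (q *: 'X_k - _) => u ec ea eb.
rewrite ec [RHS]mulrDr -scalerAr ea eb scalerAr -mulrDr; congr (u * _).
by rewrite /Sk msymD msymZ scalerBr opprD addrACA.
Qed.

Definition fz (K : fieldType) (q : K) (n : nat) (i j : 'I_(2 * n)) : polz K n :=
  (q - q^-1)^-1 *: (q *: 'X_i - q^-1 *: 'X_j).
Definition gz (K : fieldType) (q : K) (n : nat) (i : 'I_(2 * n)) : polz K n :=
  (q - q^-1)^-1 *: (q%:MP - q^-1 *: 'X_i).
Definition hz (K : fieldType) (q : K) (n : nat) (i : 'I_(2 * n)) : polz K n :=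
  (q - q^-1)^-1 *: (q *: 'X_i - (q^-1)%:MP).

Definition offdiag (n : nat) : finType :=
  {ij : 'I_(2 * n) * 'I_(2 * n) | ij.1 != ij.2}.

Definition Pz (K : fieldType) (q : K) (n : nat) (alpha : offdiag n -> nat)
    (beta gamma : 'I_(2 * n) -> nat) : polz K n :=
  (\prod_(ij : offdiag n) fz q (val ij).1 (val ij).2 ^+ alpha ij) *
  \prod_(i < 2 * n) (gz q i ^+ beta i * hz q i ^+ gamma i).

Definition param (n : nat) : finType :=
  (offdiag n + ('I_(2 * n) + 'I_(2 * n)))%type.

Lemma card_param (n : nat) : #|param n| = (2 * n * (2 * n + 1))%N.
Proof.
rewrite !card_sum !card_ord.
have cO : (#|offdiag n| + 2 * n = 2 * n * (2 * n))%N.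
  rewrite card_sig -[RHS](_ : #|{: 'I_(2 * n) * 'I_(2 * n)}| = _); last first.
    by rewrite card_prod !card_ord.
  rewrite -(cardC [pred ij : 'I_(2 * n) * 'I_(2 * n) | ij.1 != ij.2]).
  congr addn; rewrite -[LHS](card_ord (2 * n)).
  rewrite -(card_imset (f := fun i : 'I_(2 * n) => (i, i))); last by move=> i j [].
  apply: eq_card => -[i j]; rewrite !inE /= negbK.
  apply/imsetP/eqP => [[l _ [-> ->]] //|->]; by exists j.
by rewrite addnA cO mulnDr muln1.
Qed.

Definition param_val (n : nat) (alpha : offdiag n -> nat)
    (beta gamma : 'I_(2 * n) -> nat) (p : param n) : nat :=
  match p with
  | inl ij => alpha ij
  | inr (inl i) => beta i
  | inr (inr i) => gamma i
  end.

(* The point ((alpha_ij), (beta_i), (gamma_i)) of K^(2n(2n+1)), listed in the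
   order of [enum (param n)]: first the alphas, then the betas and gammas. *)
Definition param_point (K : fieldType) (n : nat) (alpha : offdiag n -> nat)
    (beta gamma : 'I_(2 * n) -> nat) (t : 'I_(2 * n * (2 * n + 1))) : K :=
  (param_val alpha beta gamma
     (enum_val (cast_ord (esym (card_param n)) t)))%:R.

(* Main.v *)
(* At z = 1 each of the linear factors f(i,j), g(i), h(i) takes the value 1, so
   it is 1 + l with l in the ideal I of the point, and P is the sum over
   exponents nu of the products of C(alpha, nu) l^nu, where C(alpha, nu) has
   degree |nu| in the parameters.  By the twisted Leibniz rule
   D_k(f g) = S_k(f) D_k(g) + D_k(f) g, the operator D_k maps I^(r+1) to I^r.
   Hence D_{i_1} ... D_{i_m} followed by evaluation at z = 1 kills I^(m+1), and
   only the terms with |nu| <= m contribute. *)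
Require Import Defs.
From HB Require Import structures.
From mathcomp Require Import all_boot all_order all_algebra all_fingroup.
From mathcomp Require Import mpoly.

Local Open Scope ring_scope.

Set Implicit Arguments.
Unset Strict Implicit.
Import GRing.Theory Num.Theory.

(* [vanish_order v r f]: f lies in the r-th power of the ideal of the point v. *)
Inductive vanish_order (N : nat) (K : fieldType) (v : 'I_N -> K) :
    nat -> {mpoly K[N]} -> Prop :=
| VanishAny f : vanish_order v 0 f
| VanishAdd r f g :
    vanish_order v r f -> vanish_order v r g -> vanish_order v r (f + g)
| VanishMul r a f :
    a.@[v] = 0 -> vanish_order v r f -> vanish_order v r.+1 (a * f).

Section VanishOrder.
Variables (N : nat) (K : fieldType) (v : 'I_N -> K).
Implicit Types f g : {mpoly K[N]}.

Lemma vanish_orderMr r f g : vanish_order v r f -> vanish_order v r (f * g).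
Proof.
move=> vf; elim: vf g => [?|r1 f1 f2 _ IH1 _ IH2|r1 a f1 a0 _ IH] g.
- exact: VanishAny.
- by rewrite mulrDl; apply: VanishAdd.
- by rewrite -mulrA; apply: VanishMul.
Qed.

Lemma vanish_orderXM r j f g :
  f.@[v] = 0 -> vanish_order v r g -> vanish_order v (j + r) (f ^+ j * g).
Proof.
move=> f0 vg; elim: j => [|j IH]; first by rewrite mul1r.
by rewrite exprS -mulrA addSn; apply: VanishMul.
Qed.

Lemma vanish_order_meval r f : vanish_order v r f -> (0 < r)%N -> f.@[v] = 0.
Proof.
elim=> [//|r1 f1 f2 _ IH1 _ IH2 r1_gt0|r1 a f1 a0 _ _ _].
  by rewrite mevalD IH1 // IH2 // addr0.
by rewrite mevalM a0 mul0r.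
Qed.

End VanishOrder.

Section Dk.
Variables (K : fieldType) (q : K) (n : nat).
Implicit Types (k : 'I_(2 * n)) (f g : {mpoly K[2 * n]}).
Local Notation one := (fun _ : 'I_(2 * n) => (1 : K)).

(** [Sk k f - f] is a multiple of ['X_(ordS k) - 'X_k], which vanishes where all coordinates are
    equal. *)
Lemma meval1_Sk k f : (Sk k f).@[one] = f.@[one].
Proof.
apply/eqP; rewrite -subr_eq0 -mevalB -divdiffE mevalM mevalB !mevalXU.
by rewrite subrr mul0r.
Qed.

(** Cancelling ['X_(ordS k) - 'X_k] leaves S(fg) - fg = S(f)(S(g) - g) + (S(f) - f)g. *)
Lemma DkM k f g : Dk q k (f * g) = Sk k f * Dk q k g + Dk q k f * g.
Proof.
apply: (mulfI (subX_neq0 K k)).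
have := DkE q k g; have := DkE q k f; have := DkE q k (f * g).
move: (Dk q k (f * g)) (Dk q k f) (Dk q k g) => dfg df dg.
move: ('X_(ordS k) - _) (q *: 'X_k - _) => w u -> ef eg.
rewrite [RHS]mulrDr mulrCA eg [w * _]mulrA ef mulrCA -mulrA -mulrDr /Sk msymM.
by congr (u * _); rewrite mulrBr mulrBl addrA subrK.
Qed.

Lemma vanish_order_Dk r k f :
  vanish_order one r f -> vanish_order one r.-1 (Dk q k f).
Proof.
elim=> [?|r1 f1 f2 _ IH1 _ IH2|r1 a f1 a0 vf IH].
- exact: VanishAny.
- have := Dk_is_linear q k 1 f1 f2; rewrite !scale1r => ->.
  exact: VanishAdd.
(* For [r1 = 0] the claimed order is 0. Otherwise [Sk k a] still vanishes at the point and restores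
   the order that [Dk q k f] lost, while in the other term [f] alone has enough order. *)
- rewrite DkM; case: r1 vf IH => [|r1] vf IH; first exact: VanishAny.
  apply: VanishAdd; first by apply: VanishMul; rewrite ?meval1_Sk.
  by rewrite mulrC; apply: vanish_orderMr.
Qed.

Lemma vanish_order_foldr_Dk (s : seq 'I_(2 * n)) r f :
  vanish_order one r f -> vanish_order one (r - size s) (foldr (@Dk K q n) f s).
Proof.
move=> vf; elim: s => [|k s IH] /=; first by rewrite subn0.
by rewrite subnS; apply: vanish_order_Dk.
Qed.

Definition meval_foldr_Dk (v : 'I_(2 * n) -> K) (s : seq 'I_(2 * n)) f :=
  (foldr (@Dk K q n) f s).@[v].

Lemma meval_foldr_Dk_is_linear v s : scalar (meval_foldr_Dk v s).
Proof.
move=> c f g; rewrite -mevalZ -mevalD; congr (_.@[v]).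
by elim: s => //= k s ->; rewrite Dk_is_linear.
Qed.

HB.instance Definition _ v s :=
  GRing.isLinear.Build K {mpoly K[2 * n]} K *%R
    (meval_foldr_Dk v s) (meval_foldr_Dk_is_linear v s).

End Dk.

Section BinomialExpansion.
Variable K : fieldType.
Hypothesis K0 : [pchar K] =i pred0.

Lemma msizeM_leq (M : nat) (p r : {mpoly K[M]}) (a b : nat) :
  (msize p <= a.+1)%N -> (msize r <= b)%N -> (msize (p * r) <= a + b)%N.
Proof.
have [->|p0] := eqVneq p 0; first by rewrite mul0r msize0.
have [->|r0] := eqVneq r 0; first by rewrite mulr0 msize0.
move=> sp sr; rewrite msizeM //.
by rewrite -subn1 leq_subLR add1n -addSn leq_add.
Qed.

(** The polynomial is x(x-1)...(x-j+1)/j! in the variable [p]; characteristic 0 makes j!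
    invertible. *)
Lemma bin_mpoly (M : nat) (p : 'I_M) (j : nat) :
  exists B : {mpoly K[M]}, (msize B <= j.+1)%N /\
    forall a : 'I_M -> nat, B.@[fun t => (a t)%:R] = 'C(a p, j)%:R.
Proof.
suff [B [sB eB]] : exists B : {mpoly K[M]}, (msize B <= j.+1)%N /\
    forall a : 'I_M -> nat, B.@[fun t => (a t)%:R] = (a p ^_ j)%:R.
  exists (j`!%:R^-1 *: B); split; first exact: leq_trans (msizeZ_le _ _) sB.
  move=> a; rewrite mevalZ eB -bin_ffact natrM mulrC mulfK //.
  by have/pcharf0P -> := K0; rewrite -lt0n fact_gt0.
elim: j => [|j [B [sB eB]]].
  by exists 1; rewrite msize1; split=> // a; rewrite meval1 ffactn0.
exists (B * ('X_p - j%:R%:MP)); split.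
  rewrite -addn2; apply: msizeM_leq => //.
  rewrite (leq_trans (msizeD_le _ _)) // geq_max msizeX mdeg1 leqnn msizeN.
  by rewrite msizeC; case: (_ != 0).
move=> a; rewrite mevalM eB mevalB mevalXU mevalC ffactnSr natrM.
(* When [a p < j] the subtraction [a p - j] truncates, but the falling factorial is then already
   0. *)
have [ja|aj] := leqP j (a p); first by rewrite natrB.
by rewrite ffact_small // !mul0r.
Qed.

(** This replaces the upper limit of a binomial expansion, which depends on the exponent, by the
    fixed limit [m]. *)
Lemma sum_ord_stable (V : nmodType) (F : nat -> V) (a b : nat) :
    (forall j, (a <= j)%N || (b <= j)%N -> F j = 0) ->
  \sum_(j < a) F j = \sum_(j < b) F j.
Proof.
move=> F0; rewrite (big_ord_widen (maxn a b)) ?leq_maxl //.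
rewrite [RHS](big_ord_widen (maxn a b)) ?leq_maxr //.
rewrite big_mkcond [RHS]big_mkcond; apply: eq_bigr => j _.
by case: ltnP => ja; case: ltnP => jb //; rewrite F0 ?ja ?jb ?orbT.
Qed.

(** Induction on [s] expands one factor at a time, and [G] collects the powers of [phi p - 1]
    already produced. Each unit of vanishing order [r] costs one degree of [Q]; for [r > m] the
    bound says [Q = 0]. *)
Lemma linear_prod_exp (N M m : nat) (v : 'I_N -> K)
    (L : {scalar {mpoly K[N]}}) (phi : 'I_M -> {mpoly K[N]}) :
    (forall r G, vanish_order v r G -> (m < r)%N -> L G = 0) ->
    (forall p, (phi p).@[v] = 1) ->
  forall (s : seq 'I_M) r G, vanish_order v r G ->
  exists Q : {mpoly K[M]}, (msize Q <= m.+1 - r)%N /\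
    forall a : 'I_M -> nat,
      L (G * \prod_(p <- s) phi p ^+ a p) = Q.@[fun t => (a t)%:R].
Proof.
move=> L0 phi1; elim=> [|p s IH] r G vG.
  exists (L G)%:MP; split; last by move=> a; rewrite big_nil mulr1 mevalC.
  rewrite msizeC; have [rm|mr] := leqP r m; last by rewrite (L0 r) ?eqxx.
  by rewrite subSn //; case: (_ != 0).
pose l := phi p - 1.
have l0 : l.@[v] = 0 by rewrite mevalB meval1 phi1 subrr.
have vlG j := vanish_orderXM j l0 vG.
have QP (j : 'I_m.+1) : exists Q : {mpoly K[M]}, (msize Q <= m.+1 - r)%N /\
    forall a : 'I_M -> nat,
      L (l ^+ j * G * \prod_(t <- s) phi t ^+ a t) *+ 'C(a p, j) =
      Q.@[fun t => (a t)%:R].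
  have [Q [sQ eQ]] := IH _ _ (vlG j); have [B [sB eB]] := bin_mpoly p j.
  (* A nonzero [Q] forces [j + r <= m], so that [m.+1 - (j + r)] does not truncate and the degree
     [j] of [B] fits exactly. *)
  have [Q0|Q0] := eqVneq Q 0.
    by exists 0; rewrite msize0; split=> // a; rewrite eQ Q0 !meval0 mul0rn.
  exists (B * Q); split; last by move=> a; rewrite mevalM eB eQ mulr_natl.
  have lt_jr : (j + r < m.+1)%N.
    by rewrite -subn_gt0 (leq_trans _ sQ) // lt0n msize_poly_eq0.
  have le_r : (r <= m.+1)%N by rewrite (leq_trans _ (ltnW lt_jr)) ?leq_addl.
  have le_j : (j <= m.+1 - r)%N by rewrite leq_subRL // addnC ltnW.
  apply: leq_trans (msizeM_leq sB sQ) _.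
  by rewrite addnC subnDA subnAC subnK.
have [Q QE] := fin_all_exists QP.
exists (\sum_j Q j); split.
  by rewrite (leq_trans (msize_sum _ _ _)) //; apply/bigmax_leqP => j _; case: (QE j).
move=> a.
pose F j := L (l ^+ j * G * \prod_(t <- s) phi t ^+ a t) *+ 'C(a p, j).
transitivity (\sum_(j < m.+1) F j); last first.
  by rewrite raddf_sum /=; apply: eq_bigr => j _; rewrite -(QE j).2.
rewrite big_cons -{1}(subrK 1 (phi p)) -/l addrC exprDn.
rewrite mulr_suml mulr_sumr raddf_sum /=.
(* Terms with [j > a p] die by the binomial coefficient, those with [j > m] because [L] kills order
   above [m]. *)
rewrite -[RHS](@sum_ord_stable _ F (a p).+1) => [|j]; last first.
  rewrite /F => /orP[aj|mj]; first by rewrite bin_small.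
  rewrite (L0 _ _ (vanish_orderMr _ (vlG j))) ?mul0rn //.
  by rewrite (leq_trans mj) // leq_addr.
apply: eq_bigr => j _; rewrite /F expr1n mul1r -raddfMn /=; congr (L _).
by rewrite mulrnAl mulrnAr mulrA (mulrC G).
Qed.

End BinomialExpansion.

Lemma pchar_Qq : [pchar Qq] =i pred0.
Proof.
apply/pcharf0P => j; rewrite -tofrac1 -tofracMn tofrac_eq0.
by rewrite -polyC1 -polyCMn polyC_eq0 pnatr_eq0.
Qed.

(** Otherwise [qq ^+ 2 = 1], against the degrees in [{poly rat}]. *)
Lemma qq_subV_neq0 : qq - qq^-1 != 0.
Proof.
have q0 : qq != 0 by rewrite tofrac_eq0 polyX_eq0.
apply/eqP => /(congr1 (fun x => x * qq)).
rewrite mulrBl mul0r mulVf // -tofracM -tofrac1 -tofracB => /eqP.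
rewrite tofrac_eq0 subr_eq0 -expr2 => /eqP/(congr1 (size \o polyseq)) /=.
by rewrite size_polyXn size_poly1.
Qed.

Section Factors.
Variables (K : fieldType) (q : K) (n : nat).

Definition factor (p : param n) : {mpoly K[2 * n]} :=
  match p with
  | inl ij => fz q (val ij).1 (val ij).2
  | inr (inl i) => gz q i
  | inr (inr i) => hz q i
  end.

Lemma meval1_factor p : q - q^-1 != 0 -> (factor p).@[fun _ => 1] = 1.
Proof.
by move=> q0; case: p => [ij|[i|i]] /=;
  rewrite mevalZ mevalB ?mevalZ ?mevalXU ?mevalC ?mulr1 mulVf.
Qed.

Lemma PzE (alpha : offdiag n -> nat) (beta gamma : 'I_(2 * n) -> nat) :
  Pz q alpha beta gamma = \prod_p factor p ^+ param_val alpha beta gamma p.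
Proof. by rewrite !big_sumType /= /Pz big_split. Qed.

End Factors.

(* [msize Q] is 1 + the total degree of [Q] (and 0 for [Q = 0]). *)
Theorem lemma19 (n m : nat) (hn : (1 <= n)%N) (i : m.-tuple 'I_(2 * n)) :
  exists Q : {mpoly Qq[2 * n * (2 * n + 1)]},
    (msize Q <= m.+1)%N /\
    forall (alpha : offdiag n -> nat) (beta gamma : 'I_(2 * n) -> nat),
      (foldr (@Dk Qq qq n) (Pz qq alpha beta gamma) i).@[fun _ => 1] =
      Q.@[param_point Qq alpha beta gamma].
Proof.
(* This is the enumeration used in [param_point], so both evaluation points agree by conversion. *)
pose param_of t : param n := enum_val (cast_ord (esym (card_param n)) t).
pose one := fun _ : 'I_(2 * n) => (1 : Qq).
pose L : {scalar {mpoly Qq[2 * n]}} := meval_foldr_Dk qq one i.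
have L0 r G : vanish_order one r G -> (m < r)%N -> L G = 0.
  move=> vG mr; apply: (vanish_order_meval (vanish_order_foldr_Dk qq i vG)).
  by rewrite size_tuple subn_gt0.
have [Q [sQ eQ]] := linear_prod_exp pchar_Qq L0
  (fun t => meval1_factor (param_of t) qq_subV_neq0)
  (index_enum _) (VanishAny one 1).
exists Q; split; first by rewrite subn0 in sQ.
move=> alpha beta gamma.
have := eQ (fun t => param_val alpha beta gamma (param_of t)).
rewrite mul1r => <-; rewrite PzE (reindex param_of) //.
apply: onW_bij; apply: bij_comp; first exact: enum_val_bij.
exact: (Bijective (cast_ordK _) (cast_ordKV _)).
Qed.
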